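(* Consider non-linear front tracks, parametrized by arc length, of bicycling geodesics in $\mathbb{R}^3$ with parameters $a,b\ge 0$. (a) The curvature of the front track is given (with the origin $t=0$ of arc length at a maximum of $\kappa^2$) by $$\kappa^2(t)=(1+a)^2-4a\,\mathrm{sn}^2(\omega t,k),\qquad \omega=\frac{\sqrt{(a+1)^2+b^2}}{2},\qquad k^2=\frac{4a}{(a+1)^2+b^2}.$$ (b) For $a\ne1$ the period of the curvature $\kappa$ is the same as the period of $\kappa^2$, given by $$T=\frac{2K(k)}{\omega}.$$ (c) For $a=1$ (constant torsion front tracks) the front track's curvature and its period are $$\kappa(t)=2\,\mathrm{cn}(\omega t,k),\qquad 2T=\frac{4K(k)}{\omega}.$$
   Context: $\mathrm{sn}(u,k)$ and $\mathrm{cn}(u,k)$ are the Jacobi elliptic functions with modulus $k$ (parameter $m=k^2$), and $K(k)$ is the complete elliptic integral of the first kind. In the case $a=1$, $b=0$ one has $k=1$, $K(1)=\infty$, and the curvature is not periodic. A bicycle path in $\mathbb{R}^3$ is a pair of curves $(\mathbf{x}(t),\mathbf{y}(t))$ (front and back tracks) such that $\mathbf{v}:=\mathbf{x}-\mathbf{y}$ satisfies $|\mathbf{v}|=1$ and $\mathbf{y}'\parallel\mathbf{v}$ for all $t$. A bicycling geodesic is a bicycle path whose length (length of the front track) between any two of its placements is critical among bicycle paths connecting these placements. Unit speed bicycling geodesics are exactly the bicycle paths for which there exist a constant vector $\mathbf{p}\in\mathbb{R}^3$ and $\mathbf{r}(t)\in\mathbb{R}^3$ with $$\mathbf{x}'=\mathbf{p}+\mathbf{r},\quad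 \mathbf{v}'=\mathbf{p}+\mathbf{r}-(\mathbf{v}\cdot\mathbf{p})\mathbf{v},\quad \mathbf{p}'=0,\quad \mathbf{r}'=(\mathbf{v}\cdot\mathbf{p})\mathbf{r}-[\mathbf{r}\cdot(\mathbf{r}+\mathbf{p})]\mathbf{v},\quad |\mathbf{v}|=1,\ \mathbf{r}\cdot\mathbf{v}=0,\ |\mathbf{x}'|=1.$$ Here $b:=\mathbf{p}\cdot(\mathbf{v}\times\mathbf{x}')$ is constant, $|b|\le|\mathbf{p}|$, and $a\ge0$ is defined by $a^2=|\mathbf{p}|^2-b^2$; by a reflection one may assume $b\ge0$. The curvature $\kappa$ is that of an analytic Frenet-Serret frame ($\mathbf{x}''=\kappa\mathbf{N}$, $|\mathbf{N}|=1$); it may change sign at inflection points and is defined up to an overall sign. *)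

(* Defs.v *)
From Stdlib Require Import Reals.
From Coquelicot Require Import Coquelicot.
Open Scope R_scope.

(** * Euclidean 3-space

    Vector addition and scaling, and derivatives of curves, are Coquelicot's
    [plus], [minus], [scal] and [is_derive] on the product module [R * R * R]. *)

Notation vec3 := (R * R * R)%type.

Definition dot (u w : vec3) : R :=
  fst (fst u) * fst (fst w) + snd (fst u) * snd (fst w) + snd u * snd w.

Definition cross (u w : vec3) : vec3 :=
  (snd (fst u) * snd w - snd u * snd (fst w),
   snd u * fst (fst w) - fst (fst u) * snd w,
   fst (fst u) * snd (fst w) - snd (fst u) * fst (fst w)).

Definition vnorm (u : vec3) : R := sqrt (dot u u).

Definition linear_curve (x : R -> vec3) : Prop :=
  exists c d : vec3, forall t, exists s : R, x t = plus c (scal s d).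

(** * Analytic functions and Frenet-Serret frames *)

Definition analytic (f : R -> R) : Prop :=
  forall t0 : R, exists c : nat -> R,
    Rbar_lt 0 (CV_radius c) /\ locally t0 (fun t => f t = PSeries c (t - t0)).

Definition analytic_vec (f : R -> vec3) : Prop :=
  analytic (fun t => fst (fst (f t))) /\
  analytic (fun t => snd (fst (f t))) /\
  analytic (fun t => snd (f t)).

(** A frame of the arc length parametrized curve [x].  The sign of [kappa] is
    not constrained: [kappa] may vanish and change sign, and
    [(N, B, kappa)] may be replaced by its opposite. *)
Record analytic_frenet_frame (x T N B : R -> vec3) (kappa tau : R -> R) : Prop := {
  frame_tangent : forall t, is_derive x t (T t);
  frame_T_unit : forall t, vnorm (T t) = 1;
  frame_N_unit : forall t, vnorm (N t) = 1;
  frame_TN_orth : forall t, dot (T t) (N t) = 0;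
  frame_binormal : forall t, B t = cross (T t) (N t);
  frame_T_deriv : forall t, is_derive T t (scal (kappa t) (N t));
  frame_N_deriv : forall t,
    is_derive N t (plus (scal (- kappa t) (T t)) (scal (tau t) (B t)));
  frame_B_deriv : forall t, is_derive B t (scal (- tau t) (N t));
  frame_T_analytic : analytic_vec T;
  frame_N_analytic : analytic_vec N;
  frame_B_analytic : analytic_vec B
}.

(** * Bicycle paths and bicycling geodesics *)

(** [x] is the front track, [y] the back track. *)
Record bicycle_path (x y : R -> vec3) : Prop := {
  bike_front_diff : forall t, exists dx : vec3, is_derive x t dx;
  bike_unit : forall t, vnorm (minus (x t) (y t)) = 1;
  bike_no_skid : forall t, exists l : R,
    is_derive y t (scal l (minus (x t) (y t)))
}.

(** The unit speed bicycling geodesics are the bicycle paths that satisfy the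
    following system for some constant vector [p] and some curve [r]; the
    parameters [a] and [b] are defined from [p]. *)
Record geodesic_equations (x v r : R -> vec3) (p : vec3) : Prop := {
  geod_x : forall t, is_derive x t (plus p (r t));
  geod_v : forall t,
    is_derive v t (minus (plus p (r t)) (scal (dot (v t) p) (v t)));
  geod_r : forall t,
    is_derive r t (minus (scal (dot (v t) p) (r t))
                         (scal (dot (r t) (plus (r t) p)) (v t)));
  geod_v_unit : forall t, vnorm (v t) = 1;
  geod_rv_orth : forall t, dot (r t) (v t) = 0;
  geod_x_unit : forall t, vnorm (plus p (r t)) = 1
}.

Definition unit_speed_bicycling_geodesic (x y r : R -> vec3) (p : vec3) : Prop :=
  bicycle_path x y /\
  geodesic_equations x (fun t => minus (x t) (y t)) r p.

(** The quantity [p . (v x x')] is constant along a geodesic; [b] is its value. *)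
Record geodesic_parameters (x y : R -> vec3) (p : vec3) (a b : R) : Prop := {
  param_b : forall t (dx : vec3), is_derive x t dx ->
    b = dot p (cross (minus (x t) (y t)) dx);
  param_a_ge0 : 0 <= a;
  param_a : a ^ 2 = dot p p - b ^ 2
}.

(** * Jacobi elliptic functions with modulus [k], for [0 <= k <= 1] *)

Definition elliptic_integrand (k theta : R) : R :=
  / sqrt (1 - k ^ 2 * sin theta ^ 2).

(** [jacobi_am u k] is the unique [phi] with
    [u = RInt (elliptic_integrand k) 0 phi].  The existence of the integral is
    part of the condition: for [k = 1] the integrand is unbounded near
    [PI / 2] and [- PI / 2], so [phi] lies strictly between these values. *)
Definition jacobi_am (u k : R) : R :=
  iota (fun phi : R => is_RInt (elliptic_integrand k) 0 phi u).

Definition sn (u k : R) : R := sin (jacobi_am u k).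
Definition cn (u k : R) : R := cos (jacobi_am u k).

(** Meaningful for [0 <= k < 1] only; the integral diverges to infinity for [k = 1]. *)
Definition ellK (k : R) : R := RInt (elliptic_integrand k) 0 (PI / 2).

(** * Periods and maxima *)

Definition is_period (f : R -> R) (P : R) : Prop :=
  0 < P /\ forall t, f (t + P) = f t.

Definition is_least_period (f : R -> R) (P : R) : Prop :=
  is_period f P /\ forall Q, is_period f Q -> P <= Q.

Definition is_max_at (f : R -> R) (t0 : R) : Prop := forall t, f t <= f t0.

(* Main.v *)
Require Import Defs.
From Stdlib Require Import Reals.
From Coquelicot Require Import Coquelicot.
From Stdlib Require Import Lra Psatz.
Open Scope R_scope.

(** Write [w = kappa ^ 2] and [q = v . p].  The geodesic equations, together with
    the Gram determinant of [p], [v], [x'], whose value is [b^2], reduce to the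
    planar system
      [w' = 2 q (w + b^2)],  [q' = (1 + a^2 - w) / 2 - q^2]
    with the first integral
      [((1 + a^2 - w) / 2)^2 + q^2 (w + b^2) = a^2]
    ([geodesic_curvature_system]).  With [sigma = sqrt (w + b^2)], the point
    [((1 + a^2 - w) / 2, q sigma)] therefore stays on the circle of radius [a],
    and it turns there with angular speed exactly [sigma].  Calling its angle
    [PI + 2 phi], one gets [w = (1 + a)^2 - 4 a sin^2 phi] and
      [phi' = sigma / 2 = omega sqrt (1 - k^2 sin^2 phi)],
    which is the differential equation of the Jacobi amplitude
    ([curvature_phase_from], [curvature_phase_elliptic]).  Recovering the circular
    motion from its angular speed is a linear problem, so no uniqueness theorem
    for the nonlinear system is required; and [w + b^2 = |r|^2] satisfies a linear
    homogeneous equation, so it is positive unless the front track is a line.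

    At a maximum of [w] the phase may be taken to be [0], and a change of variables
    in the elliptic integral gives [phi (t0 + t) = am (omega t)]
    ([phase_is_amplitude]); this is (a).  A maximum exists because a phase that
    starts in [[- PI / 2, PI / 2]] reaches [0], also in the limiting case [k = 1]
    ([phase_reaches_zero]).  For [k < 1] the phase grows by [PI] in time
    [2 K / omega] ([phase_half_turn]), which is the least period of [sin^2 phi].
    For [a <> 1] the curvature is continuous without zeros, so it keeps its sign
    and has the periods of its square; this is (b).

    For [a = 1] the squared curvature is [4 cos^2 phi], and the acceleration is
    [2 cos phi] times a continuous unit vector.  The zeros of [cos phi] are simple,
    hence isolated, so the frame normal equals that vector up to one global sign
    ([geodesic_signed_curvature]).  The torsion satisfies
    [kappa^2 tau = b (kappa^2 + a^2 - 1) / 2] ([geodesic_torsion]), so it is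
    [b / 2] off the zeros of the curvature and, again since these are isolated,
    everywhere ([geodesic_constant_torsion]). *)

(** * Real functions of one variable *)

(** Replaces the derivative left symbolic by [auto_derive] by its value. *)
Ltac derive_value H :=
  match type of H with
  | is_derive ?f ?t ?l =>
      replace (Derive (fun x : R => f x) t) with l
        by (symmetry; apply is_derive_unique; exact H)
  end.

Lemma is_derive_affine (f : R -> R) (c l t df : R) :
  is_derive f t df -> is_derive (fun u => c + l * f u) t (l * df).
Proof.
  intros Hf; auto_derive; [eexists; exact Hf|].
  derive_value Hf; ring.
Qed.

Lemma continuous_antiderivative (f : R -> R) (t0 c : R) :
  (forall t, continuous f t) ->
  exists F : R -> R, F t0 = c /\ forall t, is_derive F t (f t).
Proof.
  intros Hf.
  exists (fun t => c + RInt f t0 t); split.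
  - rewrite RInt_point; unfold zero; simpl; ring.
  - intros t.
    replace (f t) with (0 + f t) by ring.
    apply (is_derive_plus (fun _ => c) (fun u => RInt f t0 u)).
    + apply (@is_derive_const R_AbsRing R_NormedModule).
    + apply is_derive_RInt with t0; [|apply Hf].
      apply filter_forall; intros u.
      apply (@RInt_correct R_CompleteNormedModule).
      apply (@ex_RInt_continuous R_CompleteNormedModule); intros; apply Hf.
Qed.

Lemma zero_derivative_constant (f : R -> R) :
  (forall t, is_derive f t 0) -> forall t u, f t = f u.
Proof.
  intros Hf t u.
  destruct (Rtotal_order t u) as [H|[->|H]]; [|reflexivity|symmetry];
    apply eq_is_derive; auto.
Qed.

Lemma positive_derivative_increasing (f df : R -> R) :
  (forall t, is_derive f t (df t)) -> (forall t, 0 < df t) ->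
  forall t u, t < u -> f t < f u.
Proof.
  intros Hf Hdf t u Htu.
  apply (incr_function f m_infty p_infty df); simpl; auto.
  intros s _ _; apply Hdf.
Qed.

Lemma is_derive_continuity (f df : R -> R) :
  (forall t, is_derive f t (df t)) -> continuity f.
Proof.
  intros Hf t.
  apply continuity_pt_filterlim, (ex_derive_continuous f).
  eexists; apply Hf.
Qed.

Lemma nonvanishing_same_sign (f : R -> R) :
  (forall t, continuous f t) -> (forall t, f t <> 0) ->
  forall t u, 0 < f t * f u.
Proof.
  intros Hc Hf t u.
  destruct (Rlt_or_le 0 (f t * f u)) as [H|H]; [exact H|exfalso].
  assert (Hcont : continuity f)
    by (intros s; apply continuity_pt_filterlim, Hc).
  destruct (IVT_gen f t u 0 Hcont) as (s & _ & Hs).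
  - unfold Rmin, Rmax; destruct (Rle_dec (f t) (f u)); split; nra.
  - exact (Hf s Hs).
Qed.

Lemma nonvanishing_same_square (f : R -> R) :
  (forall t, continuous f t) -> (forall t, f t <> 0) ->
  forall t u, f t ^ 2 = f u ^ 2 -> f t = f u.
Proof.
  intros Hc Hf t u E.
  pose proof (nonvanishing_same_sign f Hc Hf t u) as H.
  assert (E2 : (f t - f u) * (f t + f u) = 0) by (ring_simplify; lra).
  apply Rmult_integral in E2; destruct E2; [lra|nra].
Qed.

Lemma simple_zero_isolated (f : R -> R) (t l : R) :
  is_derive f t l -> f t = 0 -> l <> 0 ->
  exists d : posreal, forall u, Rabs (u - t) < d -> u <> t -> f u <> 0.
Proof.
  intros Hf H0 Hl.
  apply is_derive_Reals in Hf.
  destruct (Hf (Rabs l) (Rabs_pos_lt l Hl)) as (d & Hd).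
  exists d; intros u Hu Hut E.
  assert (Hh : u - t <> 0) by lra.
  specialize (Hd (u - t) Hh Hu).
  replace (t + (u - t)) with u in Hd by ring.
  rewrite E, H0 in Hd.
  replace ((0 - 0) / (u - t) - l) with (- l) in Hd by (field; exact Hh).
  rewrite Rabs_Ropp in Hd; lra.
Qed.

(** Simple zeros are isolated, so a continuous [g] vanishes on a dense set. *)
Lemma vanishes_off_simple_zeros (f df g : R -> R) :
  (forall t, is_derive f t (df t)) -> (forall t, f t = 0 -> df t <> 0) ->
  (forall t, continuous g t) -> (forall t, f t * g t = 0) ->
  forall t, g t = 0.
Proof.
  intros Hf Hz Hg Hfg t.
  destruct (Req_dec (f t) 0) as [E|E].
  - destruct (simple_zero_isolated f t (df t) (Hf t) E (Hz t E)) as (d & Hd).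
    destruct (Req_dec (g t) 0) as [G|G]; [exact G|exfalso].
    assert (Hp : 0 < Rabs (g t)) by (apply Rabs_pos_lt; exact G).
    assert (Hl : locally t (fun u => Rabs (g u - g t) < Rabs (g t))).
    { exact (Hg t (fun z => Rabs (z - g t) < Rabs (g t))
               (locally_ball (g t) (mkposreal _ Hp))). }
    destruct Hl as (e & He).
    pose proof (cond_pos d); pose proof (cond_pos e).
    set (h := Rmin (d / 2) (e / 2)).
    assert (0 < h) by (apply Rmin_glb_lt; lra).
    assert (h <= d / 2) by apply Rmin_l.
    assert (h <= e / 2) by apply Rmin_r.
    assert (Hh : Rabs (t + h - t) = h)
      by (replace (t + h - t) with h by ring; apply Rabs_right; lra).
    assert (G0 : g (t + h) = 0).
    { assert (Hne : f (t + h) <> 0) by (apply Hd; lra).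
      specialize (Hfg (t + h)).
      apply Rmult_integral in Hfg; tauto. }
    assert (Hb : ball t e (t + h)) by (change (Rabs (t + h - t) < e); lra).
    specialize (He (t + h) Hb); simpl in He.
    rewrite G0 in He.
    replace (0 - g t) with (- g t) in He by ring.
    rewrite Rabs_Ropp in He; lra.
  - specialize (Hfg t); apply Rmult_integral in Hfg; tauto.
Qed.

(** By the mean value theorem [h] is constant near each isolated zero of [f], which
    gives the derivative at that zero too. *)
Lemma derivative_vanishes_off_simple_zeros (f df h dh : R -> R) :
  (forall t, is_derive f t (df t)) -> (forall t, f t = 0 -> df t <> 0) ->
  (forall t, is_derive h t (dh t)) -> (forall t, f t * dh t = 0) ->
  forall t, dh t = 0.
Proof.
  intros Hf Hz Hh Hfh t.
  destruct (Req_dec (f t) 0) as [E|E].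
  - destruct (simple_zero_isolated f t (df t) (Hf t) E (Hz t E)) as (d & Hd).
    assert (Hnear : forall u, Rabs (u - t) < d -> u <> t -> dh u = 0).
    { intros u Hu Hut.
      pose proof (Hd u Hu Hut) as Hne.
      specialize (Hfh u); apply Rmult_integral in Hfh; tauto. }
    assert (Hconst : forall u, Rabs (u - t) < d -> h u = h t).
    { intros u Hu.
      assert (Hh' : forall c, derivable_pt_lim h c (dh c))
        by (intros c; apply is_derive_Reals, Hh).
      destruct (Rtotal_order u t) as [L|[->|L]]; [|reflexivity|].
      - destruct (MVT_cor2 h dh u t L (fun c _ => Hh' c)) as (c & Ec & Hc).
        rewrite (Hnear c) in Ec; [lra| |lra].
        rewrite Rabs_left in Hu by lra; rewrite Rabs_left by lra; lra.
      - destruct (MVT_cor2 h dh t u L (fun c _ => Hh' c)) as (c & Ec & Hc).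
        rewrite (Hnear c) in Ec; [lra| |lra].
        rewrite Rabs_right in Hu by lra; rewrite Rabs_right by lra; lra. }
    rewrite <- (is_derive_unique h t _ (Hh t)).
    apply is_derive_unique.
    apply is_derive_ext_loc with (fun _ => h t).
    + exists d; intros u Hu; symmetry; apply Hconst; exact Hu.
    + apply (@is_derive_const R_AbsRing R_NormedModule).
  - specialize (Hfh t); apply Rmult_integral in Hfh; tauto.
Qed.

(** [u exp (- C)] is constant for an antiderivative [C] of [c]. *)
Lemma linear_ode_zero (u c : R -> R) (t0 : R) :
  (forall t, is_derive u t (c t * u t)) -> (forall t, continuous c t) ->
  u t0 = 0 -> forall t, u t = 0.
Proof.
  intros Hu Hc H0 t.
  destruct (continuous_antiderivative c 0 0 Hc) as (C & _ & HC).
  assert (Hd : forall s, is_derive (fun s => u s * exp (- C s)) s 0).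
  { intros s.
    pose proof (Hu s) as Hus; pose proof (HC s) as HCs.
    auto_derive.
    - repeat split; eexists; eauto.
    - derive_value Hus; derive_value HCs; ring. }
  pose proof (zero_derivative_constant _ Hd t t0) as E; simpl in E.
  rewrite H0, Rmult_0_l in E.
  apply Rmult_integral in E; destruct E as [E|E]; [exact E|].
  pose proof (exp_pos (- C t)); lra.
Qed.

(** * Elliptic integrals of the first kind *)

(** Where the radicand is not positive the integrand is [/ 0 = 0]. *)
Lemma elliptic_integrand_ge_0 (k theta : R) : 0 <= elliptic_integrand k theta.
Proof.
  unfold elliptic_integrand.
  pose proof (sqrt_pos (1 - k ^ 2 * sin theta ^ 2)) as [H|H].
  - left; apply Rinv_0_lt_compat; exact H.
  - rewrite <- H, Rinv_0; lra.
Qed.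

Lemma elliptic_integrand_ge_1 (k theta : R) :
  0 < 1 - k ^ 2 * sin theta ^ 2 -> 1 <= elliptic_integrand k theta.
Proof.
  intros H; unfold elliptic_integrand.
  apply Rle_trans with (/ 1); [lra|].
  apply Rinv_le_contravar; [apply sqrt_lt_R0; exact H|].
  apply Rle_trans with (sqrt 1); [apply sqrt_le_1_alt|rewrite sqrt_1; lra].
  pose proof (pow2_ge_0 (k * sin theta)); nra.
Qed.

Lemma elliptic_radicand_continuous (k theta : R) :
  continuous (fun th => 1 - k ^ 2 * sin th ^ 2) theta.
Proof.
  apply (ex_derive_continuous (fun th : R => 1 - k ^ 2 * sin th ^ 2)).
  auto_derive; auto.
Qed.

Lemma elliptic_integrand_continuous (k theta : R) :
  0 < 1 - k ^ 2 * sin theta ^ 2 -> continuous (elliptic_integrand k) theta.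
Proof.
  intros H.
  apply (ex_derive_continuous (elliptic_integrand k)).
  unfold elliptic_integrand; auto_derive.
  replace (1 + - (k ^ 2 * sin theta ^ 2)) with (1 - k ^ 2 * sin theta ^ 2)
    by ring.
  repeat split; auto.
  apply Rgt_not_eq, sqrt_lt_R0; exact H.
Qed.

Lemma elliptic_integrand_opp (k theta : R) :
  elliptic_integrand k (- theta) = elliptic_integrand k theta.
Proof.
  unfold elliptic_integrand; rewrite sin_neg; do 2 f_equal; ring.
Qed.

Lemma elliptic_integrand_pi (k theta : R) :
  elliptic_integrand k (theta + PI) = elliptic_integrand k theta.
Proof.
  unfold elliptic_integrand; rewrite neg_sin; do 2 f_equal; ring.
Qed.

(** The integrand is nonnegative everywhere and at least [1] near [alpha].  Only
    the point [alpha] has to be regular, which is what makes the uniqueness of the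
    amplitude uniform in [k], the singular case [k = 1] included. *)
Lemma elliptic_integral_pos (k alpha beta l : R) :
  0 < 1 - k ^ 2 * sin alpha ^ 2 -> alpha < beta ->
  is_RInt (elliptic_integrand k) alpha beta l -> 0 < l.
Proof.
  intros Ha Hab HI.
  assert (Hl : locally alpha (fun th => 0 < 1 - k ^ 2 * sin th ^ 2)).
  { apply (elliptic_radicand_continuous k alpha (fun z => 0 < z)).
    apply (open_gt 0); exact Ha. }
  destruct Hl as (d & Hd).
  pose proof (cond_pos d).
  set (m := Rmin beta (alpha + d / 2)).
  assert (alpha < m) by (apply Rmin_glb_lt; lra).
  assert (Hmb : m <= beta) by apply Rmin_l.
  assert (m <= alpha + d / 2) by apply Rmin_r.
  assert (Hex : ex_RInt (elliptic_integrand k) alpha beta) by (exists l; exact HI).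
  destruct (@ex_RInt_Chasles_1 R_CompleteNormedModule
              (elliptic_integrand k) alpha m beta)
    as (l1 & I1); [lra|exact Hex|].
  destruct (@ex_RInt_Chasles_2 R_CompleteNormedModule
              (elliptic_integrand k) alpha m beta)
    as (l2 & I2); [lra|exact Hex|].
  assert (El : l = l1 + l2).
  { pose proof (is_RInt_Chasles _ _ _ _ _ _ I1 I2) as H12.
    apply (is_RInt_unique (V := R_CompleteNormedModule)) in H12.
    apply (is_RInt_unique (V := R_CompleteNormedModule)) in HI.
    rewrite <- HI, H12; reflexivity. }
  assert (0 <= l2).
  { apply (is_RInt_ge_0 (elliptic_integrand k) m beta); auto.
    intros; apply elliptic_integrand_ge_0. }
  assert (scal (m - alpha) 1 <= l1).
  { apply (is_RInt_le (fun _ => 1) (elliptic_integrand k) alpha m); auto; [lra| |].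
    - apply (@is_RInt_const R_NormedModule).
    - intros x Hx; apply elliptic_integrand_ge_1, Hd.
      change (Rabs (x - alpha) < d); rewrite Rabs_right; lra. }
  change (scal (m - alpha) 1) with ((m - alpha) * 1) in *.
  lra.
Qed.

(** For [beta < alpha] the statement is the mirror image of the other case, the
    integrand being even. *)
Lemma elliptic_integral_injective (k alpha beta : R) :
  0 < 1 - k ^ 2 * sin alpha ^ 2 ->
  is_RInt (elliptic_integrand k) alpha beta 0 -> beta = alpha.
Proof.
  intros Ha HI.
  destruct (Rtotal_order alpha beta) as [H|[H|H]]; [|auto|].
  - pose proof (elliptic_integral_pos k alpha beta 0 Ha H HI); lra.
  - assert (HI' : is_RInt (elliptic_integrand k) (- alpha) (- beta) (opp 0)).
    { apply is_RInt_ext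
        with (fun y => opp (opp (elliptic_integrand k (- y)))).
      - intros y _; rewrite opp_opp; apply elliptic_integrand_opp.
      - apply (@is_RInt_opp R_NormedModule), (@is_RInt_comp_opp R_NormedModule).
        rewrite !Ropp_involutive; exact HI. }
    apply elliptic_integral_pos in HI'.
    + change (opp 0) with (- 0) in HI'; lra.
    + rewrite sin_neg; replace ((- sin alpha) ^ 2) with (sin alpha ^ 2) by ring.
      exact Ha.
    + lra.
Qed.

(** The differential equation of [t => am (omega t + c)], up to multiples of [PI].
    Regularity excludes, for [k = 1], the solutions that are stuck at an odd multiple
    of [PI / 2]. *)
Record elliptic_phase (omega k : R) (phi : R -> R) : Prop := {
  phase_derive : forall t,
    is_derive phi t (omega * sqrt (1 - k ^ 2 * sin (phi t) ^ 2));
  phase_regular : forall t, 0 < 1 - k ^ 2 * sin (phi t) ^ 2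
}.

Arguments phase_derive {omega k phi}.
Arguments phase_regular {omega k phi}.

Lemma phase_continuity {omega k : R} {phi : R -> R} :
  elliptic_phase omega k phi -> continuity phi.
Proof.
  intros Hphi; exact (is_derive_continuity _ _ (phase_derive Hphi)).
Qed.

Lemma phase_increasing {omega k : R} {phi : R -> R} (Hw : 0 < omega)
    (Hphi : elliptic_phase omega k phi) (t u : R) : t < u -> phi t < phi u.
Proof.
  apply (positive_derivative_increasing phi _ (phase_derive Hphi)).
  intros s; apply Rmult_lt_0_compat; [exact Hw|].
  apply sqrt_lt_R0, (phase_regular Hphi).
Qed.

(** Change of variables: along a phase the elliptic integrand is [omega / phi'].
    Every point between [phi t] and [phi u] is a value of [phi], which gives
    integrability even when the integrand has poles elsewhere. *)
Lemma phase_elapsed_time {omega k : R} {phi : R -> R}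
    (Hphi : elliptic_phase omega k phi) (t u : R) :
  is_RInt (elliptic_integrand k) (phi t) (phi u) (omega * (u - t)).
Proof.
  assert (Hex : ex_RInt (elliptic_integrand k) (phi t) (phi u)).
  { apply (@ex_RInt_continuous R_CompleteNormedModule); intros z Hz.
    destruct (IVT_gen phi t u z (phase_continuity Hphi) Hz) as (s & _ & <-).
    apply elliptic_integrand_continuous, (phase_regular Hphi). }
  apply (@RInt_correct R_CompleteNormedModule) in Hex.
  replace (omega * (u - t)) with (RInt (elliptic_integrand k) (phi t) (phi u)).
  { exact Hex. }
  transitivity (RInt (fun _ => omega) t u).
  2: { rewrite RInt_const; apply Rmult_comm. }
  symmetry.
  apply (is_RInt_unique (V := R_CompleteNormedModule)).
  apply is_RInt_ext with (fun y =>
    scal (omega * sqrt (1 - k ^ 2 * sin (phi y) ^ 2))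
      (elliptic_integrand k (phi y))).
  - intros s _; unfold elliptic_integrand.
    change (omega * sqrt (1 - k ^ 2 * sin (phi s) ^ 2)
            * / sqrt (1 - k ^ 2 * sin (phi s) ^ 2) = omega).
    field; apply Rgt_not_eq, sqrt_lt_R0, (phase_regular Hphi).
  - apply (@is_RInt_comp R_CompleteNormedModule).
    + intros s _; apply elliptic_integrand_continuous, (phase_regular Hphi).
    + intros s _; split; [apply (phase_derive Hphi)|].
      pose proof (phase_derive Hphi s).
      apply (ex_derive_continuous
        (fun u : R => omega * sqrt (1 - k ^ 2 * sin (phi u) ^ 2))).
      auto_derive.
      replace (1 + - (k ^ 2 * sin (phi s) ^ 2)) with (1 - k ^ 2 * sin (phi s) ^ 2)
        by ring.
      repeat split; auto; [eexists; eauto|apply (phase_regular Hphi)].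
Qed.

Lemma phase_is_amplitude {omega k : R} {phi : R -> R}
    (Hphi : elliptic_phase omega k phi) (t0 t : R) :
  phi t0 = 0 -> jacobi_am (omega * t) k = phi (t0 + t).
Proof.
  intros H0.
  pose proof (phase_elapsed_time Hphi t0 (t0 + t)) as HI.
  replace (omega * (t0 + t - t0)) with (omega * t) in HI by ring.
  rewrite H0 in HI.
  apply (iota_unique (V := R_CompleteNormedModule)); [|exact HI].
  intros psi Hpsi.
  apply (elliptic_integral_injective k); [apply (phase_regular Hphi)|].
  pose proof (is_RInt_Chasles _ _ _ _ _ _ (is_RInt_swap _ _ _ _ HI) Hpsi) as H.
  replace 0 with (plus (opp (omega * t)) (omega * t)); [exact H|].
  change (- (omega * t) + omega * t = 0); ring.
Qed.

(** While the phase lies between [phi t1] and [0] its speed is at least the speed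
    [c] at time [t1], because [sin ^ 2] decreases on [[- PI / 2, 0]].  So [0] is
    reached by time [t1 - phi t1 / c]. *)
Lemma phase_reaches_zero_forward {omega k : R} {phi : R -> R} (Hw : 0 < omega)
    (Hphi : elliptic_phase omega k phi) (t1 : R) :
  - (PI / 2) <= phi t1 <= 0 -> exists t0, phi t0 = 0.
Proof.
  intros H1.
  set (c := omega * sqrt (1 - k ^ 2 * sin (phi t1) ^ 2)).
  assert (Hc : 0 < c).
  { apply Rmult_lt_0_compat; [exact Hw|].
    apply sqrt_lt_R0, (phase_regular Hphi). }
  set (t2 := t1 - phi t1 / c).
  assert (H12 : t1 <= t2).
  { unfold t2; apply Rmult_le_reg_r with c; [exact Hc|].
    replace ((t1 - phi t1 / c) * c) with (t1 * c - phi t1) by (field; lra); lra. }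
  assert (H2 : 0 <= phi t2).
  { destruct (Rle_or_lt 0 (phi t2)) as [H|H]; [exact H|exfalso].
    assert (H12' : t1 < t2).
    { destruct H12 as [L|E]; [exact L|exfalso].
      rewrite <- E in H. assert (phi t1 / c = 0) by (unfold t2 in E; lra).
      assert (phi t1 = phi t1 / c * c) by (field; lra). nra. }
    destruct (MVT_cor2 phi (fun t => omega * sqrt (1 - k ^ 2 * sin (phi t) ^ 2))
                t1 t2 H12') as (s & Es & Hs).
    { intros s _; apply is_derive_Reals, (phase_derive Hphi). }
    assert (c <= omega * sqrt (1 - k ^ 2 * sin (phi s) ^ 2)).
    { apply Rmult_le_compat_l; [lra|].
      apply sqrt_le_1_alt.
      pose proof (phase_increasing Hw Hphi t1 s (proj1 Hs)).
      pose proof (phase_increasing Hw Hphi s t2 (proj2 Hs)).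
      pose proof PI_RGT_0.
      assert (sin (phi t1) <= sin (phi s)) by (apply sin_incr_1; lra).
      assert (sin (phi s) <= sin 0) by (apply sin_incr_1; lra).
      rewrite sin_0 in *.
      pose proof (pow2_ge_0 k).
      assert (sin (phi s) ^ 2 <= sin (phi t1) ^ 2) by nra.
      nra. }
    assert (c * (t2 - t1) = - phi t1) by (unfold t2; field; lra).
    nra. }
  destruct (IVT_gen phi t1 t2 0 (phase_continuity Hphi)) as (t0 & _ & E).
  - unfold Rmin, Rmax; destruct (Rle_dec (phi t1) (phi t2)); lra.
  - exists t0; exact E.
Qed.

Lemma elliptic_phase_reverse {omega k : R} {phi : R -> R} :
  elliptic_phase omega k phi -> elliptic_phase omega k (fun t => - phi (- t)).
Proof.
  intros [Hd Hr].
  assert (E : forall t, sin (- phi (- t)) ^ 2 = sin (phi (- t)) ^ 2)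
    by (intros t; rewrite sin_neg; ring).
  split; intros t; rewrite E; [|apply Hr].
  pose proof (Hd (- t)) as H.
  auto_derive; [eexists; exact H|].
  derive_value H; ring.
Qed.

Lemma phase_reaches_zero (omega k : R) (phi : R -> R) (t1 : R) :
  0 < omega -> elliptic_phase omega k phi ->
  - (PI / 2) <= phi t1 <= PI / 2 -> exists t0, phi t0 = 0.
Proof.
  intros Hw Hphi H1.
  destruct (Rle_or_lt (phi t1) 0) as [H|H].
  - apply (phase_reaches_zero_forward Hw Hphi t1); lra.
  - destruct (phase_reaches_zero_forward Hw (elliptic_phase_reverse Hphi)
                (- t1)) as (t0 & E).
    + rewrite Ropp_involutive; lra.
    + exists (- t0); lra.
Qed.

(** The integral over a period of the integrand does not depend on where it starts;
    started at [- PI / 2], it is twice [ellK k] by evenness. *)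
Lemma complete_elliptic_integral (k theta : R) :
  k ^ 2 < 1 ->
  is_RInt (elliptic_integrand k) theta (theta + PI) (2 * ellK k).
Proof.
  intros Hk.
  assert (Hc : forall th, continuous (elliptic_integrand k) th).
  { intros th; apply elliptic_integrand_continuous.
    pose proof (SIN_bound th); pose proof (pow2_ge_0 k).
    assert (sin th ^ 2 <= 1) by nra; nra. }
  destruct (continuous_antiderivative (elliptic_integrand k) 0 0 Hc)
    as (G & G0 & HG).
  assert (HI : forall u v, is_RInt (elliptic_integrand k) u v (G v - G u)).
  { intros u v; apply (@is_RInt_derive R_CompleteNormedModule); auto. }
  assert (Hodd : forall th, G th + G (- th) = 0).
  { intros th.
    assert (Hd : forall s, is_derive (fun s => G s + G (- s)) s 0).
    { intros s; pose proof (HG s) as H1; pose proof (HG (- s)) as H2.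
      auto_derive; [repeat split; eexists; eauto|].
      derive_value H1; derive_value H2; rewrite elliptic_integrand_opp; ring. }
    rewrite (zero_derivative_constant _ Hd th 0), Ropp_0, G0; ring. }
  assert (Hper : G (theta + PI) - G theta = G (- (PI / 2) + PI) - G (- (PI / 2))).
  { assert (Hd : forall s, is_derive (fun s => G (s + PI) - G s) s 0).
    { intros s; pose proof (HG s) as H1; pose proof (HG (s + PI)) as H2.
      auto_derive; [repeat split; eexists; eauto|].
      derive_value H1; derive_value H2; rewrite elliptic_integrand_pi; ring. }
    exact (zero_derivative_constant _ Hd theta (- (PI / 2))). }
  replace (2 * ellK k) with (G (theta + PI) - G theta); [apply HI|].
  unfold ellK; rewrite (is_RInt_unique _ _ _ _ (HI 0 (PI / 2))), Hper, G0.
  replace (- (PI / 2) + PI) with (PI / 2) by field.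
  specialize (Hodd (PI / 2)); lra.
Qed.

Lemma ellK_pos (k : R) : k ^ 2 < 1 -> 0 < ellK k.
Proof.
  intros Hk; pose proof PI_RGT_0.
  assert (0 < 2 * ellK k); [|lra].
  apply (elliptic_integral_pos k 0 (0 + PI)).
  - rewrite sin_0; lra.
  - lra.
  - apply complete_elliptic_integral; exact Hk.
Qed.

(** Over a time [2 K / omega] the elliptic integral grows by [2 K], as it does when
    its upper bound moves by [PI]. *)
Lemma phase_half_turn (omega k : R) (phi : R -> R) (t : R) :
  0 < omega -> elliptic_phase omega k phi -> k ^ 2 < 1 ->
  phi (t + 2 * ellK k / omega) = phi t + PI.
Proof.
  intros Hw Hphi Hk.
  apply (elliptic_integral_injective k).
  - rewrite neg_sin; replace ((- sin (phi t)) ^ 2) with (sin (phi t) ^ 2) by ring.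
    apply (phase_regular Hphi).
  - pose proof (is_RInt_swap _ _ _ _ (complete_elliptic_integral k (phi t) Hk)) as H1.
    pose proof (phase_elapsed_time Hphi t (t + 2 * ellK k / omega)) as H2.
    pose proof (is_RInt_Chasles _ _ _ _ _ _ H1 H2) as H.
    match type of H with is_RInt _ _ _ ?l => replace 0 with l; [exact H|] end.
    change (- (2 * ellK k) + omega * (t + 2 * ellK k / omega - t) = 0).
    field; lra.
Qed.

(** * The differential equation of the squared curvature *)

(** The system satisfied by [w = kappa ^ 2] and [q = v . p].  Its first integral
    [system_circle] is included because it fixes the radius of the circular motion
    that solves it. *)
Record curvature_system (a b : R) (w q : R -> R) : Prop := {
  system_w : forall t, is_derive w t (2 * q t * (w t + b ^ 2));
  system_q : forall t, is_derive q t ((1 + a ^ 2 - w t) / 2 - q t ^ 2);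
  system_circle : forall t,
    ((1 + a ^ 2 - w t) / 2) ^ 2 + q t ^ 2 * (w t + b ^ 2) = a ^ 2;
  system_pos : forall t, 0 < w t + b ^ 2
}.

Arguments system_w {a b w q}.
Arguments system_q {a b w q}.
Arguments system_circle {a b w q}.
Arguments system_pos {a b w q}.

(** [phi] parametrizes the point [((1 + a^2 - w) / 2, q sqrt (w + b^2))] as
    [(- a cos (2 phi), - a sin (2 phi))]; the fields [cphase_w] and [cphase_q] are
    these equations in terms of the angle [phi]. *)
Record curvature_phase (a b : R) (w q phi : R -> R) : Prop := {
  cphase_derive : forall t, is_derive phi t (sqrt (w t + b ^ 2) / 2);
  cphase_w : forall t, w t = (1 + a) ^ 2 - 4 * a * sin (phi t) ^ 2;
  cphase_q : forall t,
    q t * sqrt (w t + b ^ 2) = - (2 * a * sin (phi t) * cos (phi t))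
}.

Arguments cphase_derive {a b w q phi}.
Arguments cphase_w {a b w q phi}.
Arguments cphase_q {a b w q phi}.

(** The planar system says that [(X, Y)' = sigma (- Y, X)].  Integrating [sigma / 2]
    to obtain [phi] and rotating [(X, Y)] back by [2 phi] gives a constant
    vector. *)
Lemma curvature_phase_from (a b : R) (w q : R -> R) (t1 phi1 : R) :
  curvature_system a b w q ->
  (1 + a ^ 2 - w t1) / 2 = - (a * cos (2 * phi1)) ->
  q t1 * sqrt (w t1 + b ^ 2) = - (a * sin (2 * phi1)) ->
  exists phi, phi t1 = phi1 /\ curvature_phase a b w q phi.
Proof.
  intros [Hw Hq _ Hpos] HX HY.
  destruct (continuous_antiderivative (fun t => sqrt (w t + b ^ 2) / 2) t1 phi1)
    as (phi & E1 & Hphi).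
  { intros t; apply (ex_derive_continuous (fun t : R => sqrt (w t + b ^ 2) / 2)).
    auto_derive; repeat split; [eexists; apply Hw|apply Hpos]. }
  exists phi; split; [exact E1|].
  set (X := fun t => (1 + a ^ 2 - w t) / 2) in *.
  set (Y := fun t => q t * sqrt (w t + b ^ 2)) in *.
  assert (Hsq : forall t, sqrt (w t + b ^ 2) * sqrt (w t + b ^ 2) = w t + b ^ 2)
    by (intros t; apply sqrt_sqrt, Rlt_le, Hpos).
  assert (Hsp : forall t, 0 < sqrt (w t + b ^ 2))
    by (intros t; apply sqrt_lt_R0, Hpos).
  assert (HdX : forall t, is_derive X t (- (sqrt (w t + b ^ 2) * Y t))).
  { intros t; pose proof (Hw t) as H; unfold X.
    auto_derive; [eexists; exact H|].
    derive_value H; unfold Y.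
    transitivity (- q t * (w t + b ^ 2)); [field|rewrite <- (Hsq t) at 1; ring]. }
  assert (HdY : forall t, is_derive Y t (sqrt (w t + b ^ 2) * X t)).
  { intros t; pose proof (Hw t) as H; pose proof (Hq t) as H'; unfold Y.
    auto_derive; [repeat split; [eexists; exact H'|eexists; exact H|apply Hpos]|].
    derive_value H; derive_value H'; unfold X.
    replace (w t + b * (b * 1)) with (w t + b ^ 2) by ring.
    replace (2 * q t * (w t + b ^ 2))
      with (2 * q t * (sqrt (w t + b ^ 2) * sqrt (w t + b ^ 2)))
      by (rewrite Hsq; reflexivity).
    field; apply Rgt_not_eq, Hsp. }
  (* The two coordinates of the vector rotated back. *)
  assert (HU : forall t,
    X t * cos (2 * phi t) + Y t * sin (2 * phi t) = - a).
  { intros t.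
    assert (Hd : forall t,
      is_derive (fun t => X t * cos (2 * phi t) + Y t * sin (2 * phi t)) t 0).
    { intros s; pose proof (HdX s) as H1; pose proof (HdY s) as H2;
        pose proof (Hphi s) as H3.
      auto_derive; [repeat split; eexists; eauto|].
      derive_value H1; derive_value H2; derive_value H3; field. }
    rewrite (zero_derivative_constant _ Hd t t1), E1.
    unfold X, Y; rewrite HX, HY.
    pose proof (sin2_cos2 (2 * phi1)) as H; unfold Rsqr in H.
    transitivity (- a * (sin (2 * phi1) * sin (2 * phi1)
                         + cos (2 * phi1) * cos (2 * phi1))); [ring|].
    rewrite H; ring. }
  assert (HV : forall t,
    Y t * cos (2 * phi t) - X t * sin (2 * phi t) = 0).
  { intros t.
    assert (Hd : forall t,
      is_derive (fun t => Y t * cos (2 * phi t) - X t * sin (2 * phi t)) t 0).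
    { intros s; pose proof (HdX s) as H1; pose proof (HdY s) as H2;
        pose proof (Hphi s) as H3.
      auto_derive; [repeat split; eexists; eauto|].
      derive_value H1; derive_value H2; derive_value H3; field. }
    rewrite (zero_derivative_constant _ Hd t t1), E1.
    unfold X, Y; rewrite HX, HY; ring. }
  assert (Hcs : forall t, X t = - (a * cos (2 * phi t)) /\
                          Y t = - (a * sin (2 * phi t))).
  { intros t; specialize (HU t); specialize (HV t).
    pose proof (sin2_cos2 (2 * phi t)) as H; unfold Rsqr in H.
    set (c := cos (2 * phi t)) in *; set (s := sin (2 * phi t)) in *.
    split.
    - replace (X t) with ((X t * c + Y t * s) * c - (Y t * c - X t * s) * s
                          + X t * (1 - (s * s + c * c))) by ring.
      rewrite HU, HV, H; ring.
    - replace (Y t) with ((X t * c + Y t * s) * s + (Y t * c - X t * s) * c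
                          + Y t * (1 - (s * s + c * c))) by ring.
      rewrite HU, HV, H; ring. }
  split; intros t; [apply Hphi| |]; destruct (Hcs t) as (EX & EY).
  - rewrite cos_2a_sin in EX; unfold X in EX; lra.
  - rewrite sin_2a in EY; unfold Y in EY; lra.
Qed.

(** Halving a polar angle from [[- PI, PI]] puts [theta] in the interval from which
    a phase is known to reach [0]. *)
Lemma polar_half_angle (a x y : R) :
  0 <= a -> x ^ 2 + y ^ 2 = a ^ 2 ->
  exists theta, - (PI / 2) <= theta <= PI / 2 /\
    x = - (a * cos (2 * theta)) /\ y = - (a * sin (2 * theta)).
Proof.
  intros Ha Hxy.
  pose proof PI_RGT_0.
  destruct (Req_dec a 0) as [->|Ha0].
  { exists 0; repeat split; try lra; nra. }
  assert (Hc : -1 <= - x / a <= 1).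
  { split; apply Rmult_le_reg_r with a; try lra;
      replace (- x / a * a) with (- x) by (field; lra); nra. }
  pose proof (acos_bound (- x / a)).
  pose proof (cos_acos _ Hc) as Ec.
  assert (Ex : x = - (a * (- x / a))) by (field; lra).
  assert (Es : (a * sin (acos (- x / a))) ^ 2 = y ^ 2).
  { pose proof (sin2_cos2 (acos (- x / a))) as H1; unfold Rsqr in H1.
    rewrite Ec in H1.
    replace (y ^ 2) with (a ^ 2 - x ^ 2) by lra.
    transitivity (a ^ 2 * (1 - (- x / a) * (- x / a))); [rewrite <- H1; ring|].
    field; lra. }
  assert (Ey : (a * sin (acos (- x / a)) - y) * (a * sin (acos (- x / a)) + y) = 0)
    by (ring_simplify; lra).
  apply Rmult_integral in Ey; destruct Ey as [Ey|Ey].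
  - exists (- (acos (- x / a) / 2)).
    replace (2 * - (acos (- x / a) / 2)) with (- acos (- x / a)) by field.
    rewrite cos_neg, sin_neg, Ec; repeat split; lra.
  - exists (acos (- x / a) / 2).
    replace (2 * (acos (- x / a) / 2)) with (acos (- x / a)) by field.
    rewrite Ec; repeat split; lra.
Qed.

(** [w + b^2 = ((a + 1)^2 + b^2) (1 - k^2 sin^2 phi)], so [sqrt (w + b^2) / 2] is the
    elliptic speed. *)
Lemma curvature_phase_elliptic (a b : R) (w q phi : R -> R) (omega k : R) :
  0 <= a -> omega = sqrt ((a + 1) ^ 2 + b ^ 2) / 2 ->
  k ^ 2 = 4 * a / ((a + 1) ^ 2 + b ^ 2) ->
  (forall t, 0 < w t + b ^ 2) ->
  curvature_phase a b w q phi -> elliptic_phase omega k phi.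
Proof.
  intros Ha Hom Hk Hpos [Hd Hw _].
  assert (Hm : 0 < (a + 1) ^ 2 + b ^ 2) by nra.
  assert (E : forall t,
    w t + b ^ 2 = ((a + 1) ^ 2 + b ^ 2) * (1 - k ^ 2 * sin (phi t) ^ 2)).
  { intros t; rewrite Hw, Hk; field; lra. }
  assert (Hr : forall t, 0 < 1 - k ^ 2 * sin (phi t) ^ 2).
  { intros t; pose proof (Hpos t) as H; rewrite E in H.
    apply Rmult_lt_reg_l with ((a + 1) ^ 2 + b ^ 2); lra. }
  split; [|exact Hr]; intros t.
  replace (omega * sqrt (1 - k ^ 2 * sin (phi t) ^ 2))
    with (sqrt (w t + b ^ 2) / 2); [apply Hd|].
  rewrite E, Hom, sqrt_mult by (try apply Rlt_le; auto; lra); field.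
Qed.

(** A maximum occurs when the phase passes through [0]. *)
Lemma curvature_max_exists (a b : R) (w q : R -> R) :
  0 <= a -> curvature_system a b w q ->
  exists t0, w t0 = (1 + a) ^ 2 /\ is_max_at w t0.
Proof.
  intros Ha Hsys.
  set (m := (a + 1) ^ 2 + b ^ 2).
  assert (Hm : 0 < m) by (unfold m; nra).
  destruct (polar_half_angle a ((1 + a ^ 2 - w 0) / 2) (q 0 * sqrt (w 0 + b ^ 2)))
    as (theta & Hth & HX & HY); [exact Ha| |].
  { rewrite Rpow_mult_distr, pow2_sqrt
      by (apply Rlt_le, (system_pos Hsys)).
    apply (system_circle Hsys). }
  destruct (curvature_phase_from a b w q 0 theta Hsys HX HY) as (phi & E & Hphi).
  destruct (phase_reaches_zero (sqrt m / 2) (sqrt (4 * a / m)) phi 0)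
    as (t0 & E0).
  - pose proof (sqrt_lt_R0 m Hm); lra.
  - apply (curvature_phase_elliptic a b w q); auto.
    + apply pow2_sqrt.
      apply Rmult_le_pos; [lra|left; apply Rinv_0_lt_compat; exact Hm].
    + apply (system_pos Hsys).
  - rewrite E; exact Hth.
  - exists t0.
    assert (Et0 : w t0 = (1 + a) ^ 2)
      by (rewrite (cphase_w Hphi), E0, sin_0; ring).
    split; [exact Et0|]; intros t.
    rewrite Et0, (cphase_w Hphi t).
    pose proof (pow2_ge_0 (sin (phi t))); nra.
Qed.

(** The circle equation bounds [w] by [(1 + a)^2], a value that is attained; at a
    maximum the point is therefore [(- a, 0)], that is, at phase [0]. *)
Lemma curvature_phase_at_max (a b : R) (w q : R -> R) (t0 : R) :
  0 <= a -> curvature_system a b w q -> is_max_at w t0 ->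
  exists phi, phi t0 = 0 /\ curvature_phase a b w q phi.
Proof.
  intros Ha Hsys Hmax.
  destruct (curvature_max_exists a b w q Ha Hsys) as (t1 & E1 & _).
  pose proof (Hmax t1) as Hle; rewrite E1 in Hle.
  pose proof (system_circle Hsys t0) as Hc.
  pose proof (system_pos Hsys t0) as Hp.
  assert (0 <= q t0 ^ 2 * (w t0 + b ^ 2))
    by (apply Rmult_le_pos; [apply pow2_ge_0|lra]).
  assert (EX : (1 + a ^ 2 - w t0) / 2 = - a) by nra.
  assert (EY : q t0 = 0).
  { rewrite EX in Hc.
    assert (H0 : q t0 ^ 2 * (w t0 + b ^ 2) = 0) by (ring_simplify in Hc; lra).
    apply Rmult_integral in H0; destruct H0 as [H0|H0]; [nra|lra]. }
  apply (curvature_phase_from a b w q t0 0 Hsys).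
  - rewrite EX, Rmult_0_r, cos_0; ring.
  - rewrite EY, Rmult_0_r, sin_0; ring.
Qed.

(** * Euclidean 3-space *)

Lemma is_derive_fst {U V : NormedModule R_AbsRing} (f : R -> U * V) (t : R)
    (l : U * V) :
  is_derive f t l -> is_derive (fun s => fst (f s)) t (fst l).
Proof.
  intros H.
  exact (filterdiff_comp' f fst t _ fst H
           (filterdiff_linear _ (@is_linear_fst R_AbsRing U V))).
Qed.

Lemma is_derive_snd {U V : NormedModule R_AbsRing} (f : R -> U * V) (t : R)
    (l : U * V) :
  is_derive f t l -> is_derive (fun s => snd (f s)) t (snd l).
Proof.
  intros H.
  exact (filterdiff_comp' f snd t _ snd H
           (filterdiff_linear _ (@is_linear_snd R_AbsRing U V))).
Qed.

Lemma is_derive_components (f : R -> vec3) (t : R) (l : vec3) :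
  is_derive f t l ->
  is_derive (fun s => fst (fst (f s))) t (fst (fst l)) /\
  is_derive (fun s => snd (fst (f s))) t (snd (fst l)) /\
  is_derive (fun s => snd (f s)) t (snd l).
Proof.
  intros H.
  pose proof (is_derive_fst _ _ _ H) as H1.
  split; [|split].
  - exact (is_derive_fst _ _ _ H1).
  - exact (is_derive_snd _ _ _ H1).
  - exact (is_derive_snd _ _ _ H).
Qed.

Lemma is_derive_vec3_unique (f : R -> vec3) (t : R) (l l' : vec3) :
  is_derive f t l -> is_derive f t l' -> l = l'.
Proof.
  intros H H'.
  apply is_derive_components in H; apply is_derive_components in H'.
  destruct H as (H1 & H2 & H3), H' as (H1' & H2' & H3').
  apply is_derive_unique in H1, H2, H3, H1', H2', H3'.
  destruct l as ((l1, l2), l3), l' as ((l1', l2'), l3'); simpl in *.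
  congruence.
Qed.

(** Simplifying exposes the operations of a product module one factor at a time,
    hence the repeated unfolding. *)
Ltac vec_ring :=
  intros;
  repeat match goal with u : vec3 |- _ => destruct u as ((?, ?), ?) end;
  unfold dot, cross, minus, plus, opp, scal, mult; simpl;
  unfold minus, plus, opp, scal, mult; simpl;
  unfold mult; simpl; ring.

Lemma dot_comm (u w : vec3) : dot u w = dot w u.
Proof. vec_ring. Qed.
Lemma dot_plus_l (u w z : vec3) : dot (plus u w) z = dot u z + dot w z.
Proof. vec_ring. Qed.
Lemma dot_plus_r (u w z : vec3) : dot z (plus u w) = dot z u + dot z w.
Proof. vec_ring. Qed.
Lemma dot_minus_l (u w z : vec3) : dot (minus u w) z = dot u z - dot w z.
Proof. vec_ring. Qed.
Lemma dot_minus_r (u w z : vec3) : dot z (minus u w) = dot z u - dot z w.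
Proof. vec_ring. Qed.
Lemma dot_scal_l (c : R) (u z : vec3) : dot (scal c u) z = c * dot u z.
Proof. vec_ring. Qed.
Lemma dot_scal_r (c : R) (u z : vec3) : dot z (scal c u) = c * dot z u.
Proof. vec_ring. Qed.

Lemma dot_cross_r (u w : vec3) : dot (cross u w) w = 0.
Proof. vec_ring. Qed.
Lemma dot_cross_scal (c : R) (u w z : vec3) :
  dot (cross u (scal c w)) z = c * dot (cross u w) z.
Proof. vec_ring. Qed.

Lemma dot_self_ge_0 (u : vec3) : 0 <= dot u u.
Proof. unfold dot; nra. Qed.

Lemma vnorm_1_dot (u : vec3) : vnorm u = 1 -> dot u u = 1.
Proof.
  unfold vnorm; intros H.
  rewrite <- (sqrt_sqrt (dot u u)) by apply dot_self_ge_0.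
  rewrite H; ring.
Qed.

Lemma is_derive_dot (u w : R -> vec3) (t : R) (du dw : vec3) :
  is_derive u t du -> is_derive w t dw ->
  is_derive (fun s => dot (u s) (w s)) t (dot du (w t) + dot (u t) dw).
Proof.
  intros Hu Hw.
  apply is_derive_components in Hu; apply is_derive_components in Hw.
  destruct Hu as (U1 & U2 & U3), Hw as (W1 & W2 & W3).
  assert (Hmul : forall (f g : R -> R) (df dg : R),
    is_derive f t df -> is_derive g t dg ->
    is_derive (fun s => f s * g s) t (df * g t + f t * dg)).
  { intros f g df dg Hf Hg.
    auto_derive; [repeat split; eexists; eauto|].
    derive_value Hf; derive_value Hg; ring. }
  pose proof (is_derive_plus _ _ _ _ _
                (is_derive_plus _ _ _ _ _ (Hmul _ _ _ _ U1 W1) (Hmul _ _ _ _ U2 W2))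
                (Hmul _ _ _ _ U3 W3)) as H.
  match type of H with is_derive _ _ ?l =>
    replace (dot du (w t) + dot (u t) dw) with l; [exact H|] end.
  unfold dot, plus; simpl; ring.
Qed.

Lemma dot_continuous (u w du dw : R -> vec3) (t : R) :
  (forall s, is_derive u s (du s)) -> (forall s, is_derive w s (dw s)) ->
  continuous (fun s => dot (u s) (w s)) t.
Proof.
  intros Hu Hw.
  apply (ex_derive_continuous (fun s => dot (u s) (w s))).
  eexists; apply is_derive_dot; [apply Hu|apply Hw].
Qed.

Lemma is_derive_dot_const_l (c : vec3) (w : R -> vec3) (t : R) (dw : vec3) :
  is_derive w t dw -> is_derive (fun s => dot c (w s)) t (dot c dw).
Proof.
  intros Hw.
  replace (dot c dw) with (dot zero (w t) + dot c dw)
    by (unfold dot, zero; simpl; unfold zero; simpl; ring).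
  apply (is_derive_dot (fun _ => c)); [|exact Hw].
  apply (@is_derive_const R_AbsRing).
Qed.

Lemma constant_velocity_linear (x : R -> vec3) (d : vec3) :
  (forall t, is_derive x t d) -> linear_curve x.
Proof.
  intros Hx.
  exists (x 0), d; intros t; exists t.
  assert (H : forall f : R -> R, forall l,
    (forall t, is_derive f t l) -> f t = f 0 + t * l).
  { intros f l Hf.
    assert (Hd : forall s, is_derive (fun s => f s - s * l) s 0).
    { intros s; pose proof (Hf s) as H; auto_derive; [eexists; exact H|].
      derive_value H; ring. }
    pose proof (zero_derivative_constant _ Hd t 0) as E; simpl in E; lra. }
  pose proof (H _ _ (fun t => proj1 (is_derive_components _ _ _ (Hx t)))) as E1.
  pose proof (H _ _ (fun t => proj1 (proj2 (is_derive_components _ _ _ (Hx t)))))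
    as E2.
  pose proof (H _ _ (fun t => proj2 (proj2 (is_derive_components _ _ _ (Hx t)))))
    as E3.
  simpl in E1, E2, E3.
  destruct (x t) as ((x1, x2), x3), (x 0) as ((y1, y2), y3), d as ((d1, d2), d3).
  simpl in *; rewrite E1, E2, E3; reflexivity.
Qed.

Lemma gram_determinant (u v w : vec3) :
  dot u (cross v w) ^ 2 =
    dot u u * (dot v v * dot w w - dot v w ^ 2)
    - dot u v * (dot u v * dot w w - dot v w * dot u w)
    + dot u w * (dot u v * dot v w - dot v v * dot u w).
Proof. vec_ring. Qed.

(** The triple product [(x' x x'') . x'''] for [x' = T], [x'' = q r - s v] and the
    derivatives of [r] and [v] along a geodesic. *)
Lemma geodesic_torsion_determinant (p v r : vec3) (q s dq ds : R) :
  let T := plus p r in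
  let dr := minus (scal q r) (scal s v) in
  let dv := minus T (scal q v) in
  dot (cross T dr)
      (minus (plus (scal dq r) (scal q dr)) (plus (scal ds v) (scal s dv)))
  = dot p (cross v T) * (q * ds - s * (dq + q ^ 2)).
Proof. vec_ring. Qed.

(** * Curvature and torsion of a geodesic *)

(** The constancy of [b] is expressed on the tangent [p + r] rather than on an
    arbitrary derivative of [x]. *)
Record framed_geodesic (x v r : R -> vec3) (p : vec3) (a b : R)
    (T N B : R -> vec3) (kappa tau : R -> R) : Prop := {
  framed_equations : geodesic_equations x v r p;
  framed_b : forall t, b = dot p (cross (v t) (plus p (r t)));
  framed_a : a ^ 2 = dot p p - b ^ 2;
  framed_frame : analytic_frenet_frame x T N B kappa tau
}.

Arguments framed_equations {x v r p a b T N B kappa tau}.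
Arguments framed_b {x v r p a b T N B kappa tau}.
Arguments framed_a {x v r p a b T N B kappa tau}.
Arguments framed_frame {x v r p a b T N B kappa tau}.
Arguments geod_x {x v r p}.
Arguments geod_v {x v r p}.
Arguments geod_r {x v r p}.
Arguments geod_v_unit {x v r p}.
Arguments geod_rv_orth {x v r p}.
Arguments geod_x_unit {x v r p}.
Arguments param_a_ge0 {x y p a b}.
Arguments frame_tangent {x T N B kappa tau}.
Arguments frame_N_unit {x T N B kappa tau}.
Arguments frame_T_deriv {x T N B kappa tau}.
Arguments frame_N_deriv {x T N B kappa tau}.
Arguments frame_B_deriv {x T N B kappa tau}.
Arguments frame_binormal {x T N B kappa tau}.

Lemma framed_geodesic_intro {x y r : R -> vec3} {p : vec3} {a b : R}
    {T N B : R -> vec3} {kappa tau : R -> R} :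
  unit_speed_bicycling_geodesic x y r p -> geodesic_parameters x y p a b ->
  analytic_frenet_frame x T N B kappa tau ->
  framed_geodesic x (fun t => minus (x t) (y t)) r p a b T N B kappa tau.
Proof.
  intros [_ Hg] [Hb _ Ha] Hf; split; auto.
  intros t; apply Hb, (geod_x Hg).
Qed.

Lemma geodesic_tangent {x v r : R -> vec3} {p : vec3} {a b : R}
    {T N B : R -> vec3} {kappa tau : R -> R}
    (H : framed_geodesic x v r p a b T N B kappa tau) (t : R) : T t = plus p (r t).
Proof.
  pose proof (framed_equations H) as Hg.
  pose proof (framed_frame H) as Hf.
  apply (is_derive_vec3_unique x t); [apply (frame_tangent Hf)|].
  apply (geod_x Hg).
Qed.

Lemma geodesic_acceleration {x v r : R -> vec3} {p : vec3} {a b : R}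
    {T N B : R -> vec3} {kappa tau : R -> R}
    (H : framed_geodesic x v r p a b T N B kappa tau) (t : R) :
  scal (kappa t) (N t) =
  minus (scal (dot (v t) p) (r t)) (scal (dot (r t) (plus (r t) p)) (v t)).
Proof.
  pose proof (framed_equations H) as Hg.
  pose proof (framed_frame H) as Hf.
  apply (is_derive_vec3_unique T t); [apply (frame_T_deriv Hf)|].
  apply is_derive_ext with (fun t => plus p (r t)).
  - intros s; symmetry; apply (geodesic_tangent H).
  - match goal with |- is_derive _ _ ?l => rewrite <- (plus_zero_l l) end.
    apply (is_derive_plus (fun _ => p) r); [apply (@is_derive_const R_AbsRing)|].
    apply (geod_r Hg).
Qed.

(** [s] is [r . x'].  The unit length of [x'] determines [|r|^2], the Gram
    determinant of [p], [v], [x'] (equal to [b^2]) gives the circle equation, and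
    then [kappa^2 = |x''|^2] is affine in [s]. *)
Lemma geodesic_dot_products {x v r : R -> vec3} {p : vec3} {a b : R}
    {T N B : R -> vec3} {kappa tau : R -> R}
    (H : framed_geodesic x v r p a b T N B kappa tau) (t : R) :
  let s := 1 - dot p p - dot p (r t) in
  dot (v t) (v t) = 1 /\ dot (r t) (plus (r t) p) = s /\
  dot p p = a ^ 2 + b ^ 2 /\
  dot (r t) (r t) = (a ^ 2 - 1 + 2 * s) + b ^ 2 /\
  (1 - s) ^ 2 + dot (v t) p ^ 2 * ((a ^ 2 - 1 + 2 * s) + b ^ 2) = a ^ 2 /\
  kappa t ^ 2 = a ^ 2 - 1 + 2 * s.
Proof.
  pose proof (framed_equations H) as Hg.
  pose proof (framed_frame H) as Hf.
  intros s.
  pose proof (vnorm_1_dot _ (geod_v_unit Hg t)) as Hvv.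
  pose proof (geod_rv_orth Hg t) as Hrv.
  pose proof (vnorm_1_dot _ (geod_x_unit Hg t)) as HTT.
  pose proof (vnorm_1_dot _ (frame_N_unit Hf t)) as HNN.
  pose proof (framed_a H) as Ha.
  pose proof (framed_b H t) as Hb.
  pose proof (gram_determinant p (v t) (plus p (r t))) as Hgram.
  rewrite <- Hb, HTT, Hvv, !dot_plus_r, (dot_comm (v t) (r t)), Hrv,
    (dot_comm p (v t)) in Hgram.
  rewrite dot_plus_l, !dot_plus_r, (dot_comm (r t) p) in HTT.
  pose proof (f_equal (fun u => dot u u) (geodesic_acceleration H t)) as Hacc.
  simpl in Hacc.
  rewrite dot_minus_l, !dot_minus_r, !dot_scal_l, !dot_scal_r, HNN,
    (dot_comm (v t) (r t)), Hrv, Hvv, dot_plus_r, (dot_comm (r t) p) in Hacc.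
  rewrite dot_plus_r, (dot_comm (r t) p).
  assert (Hpr : dot p (r t) = 1 - s - dot p p) by (unfold s; ring).
  assert (Hpp : dot p p = a ^ 2 + b ^ 2) by lra.
  clearbody s.
  set (q := dot (v t) p) in *; set (rr := dot (r t) (r t)) in *.
  set (pr := dot p (r t)) in *; set (pp := dot p p) in *.
  assert (Hrr : rr = (a ^ 2 - 1 + 2 * s) + b ^ 2) by lra.
  assert (Hcirc : (1 - s) ^ 2 + q ^ 2 * ((a ^ 2 - 1 + 2 * s) + b ^ 2) = a ^ 2).
  { rewrite Hpr, Hpp in Hgram; lra. }
  repeat split; auto; try lra.
  replace (kappa t ^ 2) with (kappa t * (kappa t * 1)) by ring.
  rewrite Hacc.
  replace (rr + pr) with s by lra.
  rewrite Hrr; lra.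
Qed.

(** [w + b^2 = |r|^2 >= 0] solves the linear equation [u' = 2 q u].  If it vanished
    at one time it would vanish identically, and the zero curvature would make [x]
    a line. *)
Lemma geodesic_curvature_system {x v r : R -> vec3} {p : vec3} {a b : R}
    {T N B : R -> vec3} {kappa tau : R -> R}
    (H : framed_geodesic x v r p a b T N B kappa tau) :
  ~ linear_curve x ->
  curvature_system a b (fun t => kappa t ^ 2) (fun t => dot (v t) p).
Proof.
  pose proof (framed_equations H) as Hg.
  pose proof (framed_frame H) as Hf.
  intros Hnl.
  assert (Hdw : forall t, is_derive (fun t => kappa t ^ 2) t
      (2 * dot (v t) p * (kappa t ^ 2 + b ^ 2))).
  { intros t.
    apply is_derive_ext with
      (fun t => (a ^ 2 + 1 - 2 * dot p p) + -2 * dot p (r t)).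
    { intros u; destruct (geodesic_dot_products H u) as (_ & _ & _ & _ & _ & Ek).
      rewrite Ek; simpl; ring. }
    pose proof (is_derive_dot_const_l p r t _ (geod_r Hg t)) as Hd.
    destruct (geodesic_dot_products H t) as (_ & Es & Hpp & _ & _ & Ek).
    rewrite dot_minus_r, !dot_scal_r, Es, (dot_comm p (v t)) in Hd.
    replace (2 * dot (v t) p * (kappa t ^ 2 + b ^ 2)) with
      (-2 * (dot (v t) p * dot p (r t)
             - (1 - dot p p - dot p (r t)) * dot (v t) p))
      by (rewrite Ek, Hpp; ring).
    apply is_derive_affine; exact Hd. }
  assert (Hdq : forall t, is_derive (fun t => dot (v t) p) t
      ((1 + a ^ 2 - kappa t ^ 2) / 2 - dot (v t) p ^ 2)).
  { intros t.
    apply is_derive_ext with (fun t => dot p (v t)).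
    { intros u; apply dot_comm. }
    pose proof (is_derive_dot_const_l p v t _ (geod_v Hg t)) as Hd.
    destruct (geodesic_dot_products H t) as (_ & _ & _ & _ & _ & Ek).
    match type of Hd with is_derive _ _ ?l =>
      replace ((1 + a ^ 2 - kappa t ^ 2) / 2 - dot (v t) p ^ 2) with l;
        [exact Hd|] end.
    rewrite dot_minus_r, dot_scal_r, dot_plus_r, Ek, (dot_comm p (v t)); field. }
  assert (Hr2 : forall t, kappa t ^ 2 + b ^ 2 = dot (r t) (r t)).
  { intros t; destruct (geodesic_dot_products H t) as (_ & _ & _ & E & _ & Ek); lra. }
  split; auto.
  - intros t; destruct (geodesic_dot_products H t) as (_ & _ & _ & _ & E & Ek).
    etransitivity; [|exact E]; rewrite Ek; field.
  - intros t0.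
    destruct (Req_dec (kappa t0 ^ 2 + b ^ 2) 0) as [E0|E0].
    2: { pose proof (dot_self_ge_0 (r t0)); rewrite <- Hr2 in *; lra. }
    exfalso; apply Hnl.
    assert (Hk0 : forall t, kappa t = 0).
    { intros t.
      assert (E : kappa t ^ 2 + b ^ 2 = 0).
      { apply (linear_ode_zero (fun t => kappa t ^ 2 + b ^ 2)
                 (fun t => 2 * dot (v t) p) t0); [| |exact E0].
        - intros u; pose proof (Hdw u) as Hd.
          apply is_derive_ext with (fun t => b ^ 2 + 1 * kappa t ^ 2);
            [intros z; simpl; ring|].
          rewrite <- (Rmult_1_l (2 * _ * _)).
          apply is_derive_affine; exact Hd.
        - intros u; apply (ex_derive_continuous (fun t : R => 2 * dot (v t) p)).
          eexists; apply is_derive_scal, Hdq. }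
      pose proof (pow2_ge_0 b); pose proof (pow2_ge_0 (kappa t)); nra. }
    apply (constant_velocity_linear x (T 0)); intros t.
    replace (T 0) with (T t); [apply (frame_tangent Hf)|].
    assert (HT : forall u, is_derive T u zero).
    { intros u.
      assert (E : scal (kappa u) (N u) = zero)
        by (rewrite Hk0; exact (scal_zero_l (N u))).
      exact (eq_ind _ (is_derive T u) (frame_T_deriv Hf u) _ E). }
    destruct (Rtotal_order t 0) as [L|[->|L]]; [|reflexivity|symmetry];
      apply (eq_is_derive T); auto.
Qed.

(** Differentiating [B . T' = 0] gives [tau kappa = B . T''], where
    [kappa B = T x T']; this avoids a derivative of [kappa]. *)
Lemma geodesic_torsion {x v r : R -> vec3} {p : vec3} {a b : R}
    {T N B : R -> vec3} {kappa tau : R -> R}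
    (H : framed_geodesic x v r p a b T N B kappa tau) (t : R) :
  ~ linear_curve x ->
  kappa t ^ 2 * tau t = b * (kappa t ^ 2 + a ^ 2 - 1) / 2.
Proof.
  pose proof (framed_equations H) as Hg.
  pose proof (framed_frame H) as Hf.
  intros Hnl.
  pose proof (geodesic_curvature_system H Hnl) as Hsys.
  set (q := fun t => dot (v t) p).
  set (s := fun t => (kappa t ^ 2 + 1 - a ^ 2) / 2).
  set (dq := (1 + a ^ 2 - kappa t ^ 2) / 2 - q t ^ 2).
  set (ds := q t * (kappa t ^ 2 + b ^ 2)).
  assert (Hs : forall u, dot (r u) (plus (r u) p) = s u).
  { intros u; destruct (geodesic_dot_products H u) as (_ & Es & _ & _ & _ & Ek).
    unfold s; rewrite Ek, Es; field. }
  set (A := fun u => minus (scal (q u) (r u)) (scal (s u) (v u))).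
  assert (HA : forall u, scal (kappa u) (N u) = A u).
  { intros u; rewrite (geodesic_acceleration H), Hs; reflexivity. }
  set (dr := minus (scal (q t) (r t)) (scal (s t) (v t))).
  set (dv := minus (plus p (r t)) (scal (q t) (v t))).
  set (dA := minus (plus (scal dq (r t)) (scal (q t) dr))
                   (plus (scal ds (v t)) (scal (s t) dv))).
  assert (Hscal : forall (f : R -> R) (u : R -> vec3) (df : R) (du : vec3),
    is_derive f t df -> is_derive u t du ->
    is_derive (fun z => scal (f z) (u z)) t
      (plus (scal df (u t)) (scal (f t) du))).
  { intros f u df du Hdf Hdu.
    eapply filterdiff_ext_lin.
    - apply (filterdiff_scal_fct t f u); [intros; apply Rmult_comm|exact Hdf|exact Hdu].
    - intros y; simpl; rewrite scal_distr_l, !scal_assoc.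
      do 2 f_equal; apply Rmult_comm. }
  assert (HdA : is_derive A t dA).
  { apply (is_derive_minus (fun u => scal (q u) (r u)) (fun u => scal (s u) (v u)));
      apply Hscal.
    - apply (system_q Hsys).
    - unfold dr; rewrite <- Hs; apply (geod_r Hg).
    - pose proof (system_w Hsys t) as Hd.
      unfold s.
      apply is_derive_ext with (fun t => (1 - a ^ 2) / 2 + / 2 * kappa t ^ 2).
      { intros u; simpl; field. }
      replace ds with (/ 2 * (2 * dot (v t) p * (kappa t ^ 2 + b ^ 2)))
        by (unfold ds, q; field).
      apply is_derive_affine; exact Hd.
    - apply (geod_v Hg). }
  assert (HBA : dot (scal (- tau t) (N t)) (A t) + dot (B t) dA = 0).
  { pose proof (is_derive_dot B A t _ _ (frame_B_deriv Hf t) HdA) as Hd.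
    assert (H0 : forall u, dot (B u) (A u) = 0).
    { intros u; rewrite <- HA, (frame_binormal Hf u), dot_scal_r, dot_cross_r.
      simpl; ring. }
    rewrite <- (is_derive_unique _ _ _ Hd).
    apply is_derive_unique, is_derive_ext with (fun _ => 0).
    - intros u; rewrite H0; reflexivity.
    - apply (@is_derive_const R_AbsRing R_NormedModule). }
  rewrite <- HA, dot_scal_l, dot_scal_r in HBA.
  rewrite (vnorm_1_dot _ (frame_N_unit Hf t)) in HBA.
  assert (E : kappa t ^ 2 * tau t = dot (cross (plus p (r t)) dr) dA).
  { transitivity (kappa t * dot (B t) dA).
    - transitivity (kappa t * (kappa t * tau t)); [ring|f_equal; lra].
    - rewrite (frame_binormal Hf t), <- (geodesic_tangent H).
      change dr with (A t); rewrite <- HA, dot_cross_scal; reflexivity. }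
  rewrite E; unfold dA, dv, dr.
  rewrite geodesic_torsion_determinant.
  rewrite <- (framed_b H t).
  pose proof (system_circle Hsys t) as Hc; simpl in Hc.
  fold (q t) in Hc.
  replace (q t * ds - s t * (dq + q t ^ 2))
    with (q t ^ 2 * (kappa t ^ 2 + b ^ 2)
          - s t * ((1 + a ^ 2 - kappa t ^ 2) / 2)) by (unfold ds, dq; ring).
  replace (q t ^ 2 * (kappa t ^ 2 + b ^ 2))
    with (a ^ 2 - ((1 + a ^ 2 - kappa t ^ 2) / 2) ^ 2) by lra.
  unfold s; field.
Qed.

(** The normal component of the acceleration [q r - s v]. *)
Lemma geodesic_curvature_formula {x v r : R -> vec3} {p : vec3} {a b : R}
    {T N B : R -> vec3} {kappa tau : R -> R}
    (H : framed_geodesic x v r p a b T N B kappa tau) (t : R) :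
  kappa t = dot (v t) p * dot (N t) (r t)
            - (kappa t ^ 2 + 1 - a ^ 2) / 2 * dot (N t) (v t).
Proof.
  destruct (geodesic_dot_products H t)
    as (_ & Es & _ & _ & _ & Ek).
  pose proof (f_equal (dot (N t)) (geodesic_acceleration H t))
    as E.
  rewrite dot_minus_r, !dot_scal_r, Es in E.
  rewrite (vnorm_1_dot (N t)) in E
    by (apply (frame_N_unit (framed_frame H))).
  rewrite Ek.
  transitivity (kappa t * 1); [ring|rewrite E; field].
Qed.

Lemma geodesic_curvature_continuous {x v r : R -> vec3} {p : vec3} {a b : R}
    {T N B : R -> vec3} {kappa tau : R -> R}
    (H : framed_geodesic x v r p a b T N B kappa tau) (t : R) :
  ~ linear_curve x ->
  continuous kappa t.
Proof.
  intros Hnl.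
  pose proof (framed_equations H) as Hg.
  pose proof (framed_frame H) as Hf.
  pose proof (geodesic_curvature_system H Hnl) as Hsys.
  assert (Hq : ex_derive (fun u => dot (v u) p) t)
    by (eexists; apply (system_q Hsys)).
  assert (Hs : ex_derive (fun u => (1 - a ^ 2) / 2 + / 2 * kappa u ^ 2) t)
    by (eexists; apply is_derive_affine, (system_w Hsys)).
  assert (Hr : ex_derive (fun u => dot (N u) (r u)) t).
  { eexists; apply is_derive_dot;
      [apply (frame_N_deriv Hf)|apply (geod_r Hg)]. }
  assert (Hv : ex_derive (fun u => dot (N u) (v u)) t).
  { eexists; apply is_derive_dot;
      [apply (frame_N_deriv Hf)|apply (geod_v Hg)]. }
  apply continuous_ext with (fun u =>
    dot (v u) p * dot (N u) (r u)
    - ((1 - a ^ 2) / 2 + / 2 * kappa u ^ 2) * dot (N u) (v u)).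
  { intros u; rewrite (geodesic_curvature_formula H u) at 2.
    simpl; field. }
  apply (continuous_minus (V := R_NormedModule));
    apply (continuous_mult (K := R_AbsRing));
    (apply (@ex_derive_continuous R_AbsRing R_NormedModule); assumption).
Qed.

(** * Signed curvature and torsion in the case [a = 1] *)

Lemma phase_cos_derive (a b : R) (w q phi : R -> R) (t : R) :
  curvature_phase a b w q phi ->
  is_derive (fun s => cos (phi s)) t (- sin (phi t) * (sqrt (w t + b ^ 2) / 2)).
Proof.
  intros Hphi; pose proof (cphase_derive Hphi t) as Hd.
  auto_derive; [eexists; exact Hd|].
  derive_value Hd; ring.
Qed.

Lemma phase_cos_simple_zeros (a b : R) (w q phi : R -> R) (t : R) :
  curvature_system a b w q -> cos (phi t) = 0 ->
  - sin (phi t) * (sqrt (w t + b ^ 2) / 2) <> 0.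
Proof.
  intros Hsys Hc.
  pose proof (sqrt_lt_R0 _ (system_pos Hsys t)).
  pose proof (sin2_cos2 (phi t)) as E; unfold Rsqr in E; rewrite Hc in E.
  apply Rmult_integral_contrapositive_currified; [|lra].
  intros Hs; assert (sin (phi t) = 0) by lra; nra.
Qed.

(** For [a = 1] the acceleration is [2 cos phi] times the vector
    [- (sin phi / sigma) r - (cos phi) v].  Its product [delta] with the frame
    normal is continuous and [delta ^ 2 = 1] off the isolated zeros of [cos phi],
    so [delta] is globally [1] or globally [-1]. *)
Lemma geodesic_signed_curvature {x v r : R -> vec3} {p : vec3} {b : R}
    {T N B : R -> vec3} {kappa tau : R -> R}
    (H : framed_geodesic x v r p 1 b T N B kappa tau) (phi : R -> R) :
  ~ linear_curve x ->
  curvature_phase 1 b (fun t => kappa t ^ 2) (fun t => dot (v t) p) phi ->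
  (forall t, kappa t = 2 * cos (phi t)) \/ (forall t, kappa t = - (2 * cos (phi t))).
Proof.
  intros Hnl Hphi.
  pose proof (framed_equations H) as Hg.
  pose proof (framed_frame H) as Hf.
  pose proof (geodesic_curvature_system H Hnl) as Hsys.
  assert (Hsp : forall t, 0 < sqrt (kappa t ^ 2 + b ^ 2))
    by (intros t; apply sqrt_lt_R0, (system_pos Hsys)).
  assert (Hk2 : forall t, kappa t ^ 2 = 4 * cos (phi t) ^ 2).
  { intros t; rewrite (cphase_w Hphi t).
    pose proof (sin2_cos2 (phi t)) as E; unfold Rsqr in E; nra. }
  set (delta := fun t =>
    - (sin (phi t) / sqrt (kappa t ^ 2 + b ^ 2)) * dot (N t) (r t)
    - cos (phi t) * dot (N t) (v t)).
  assert (Hkd : forall t, kappa t = 2 * cos (phi t) * delta t).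
  { intros t; rewrite (geodesic_curvature_formula H t).
    pose proof (cphase_q Hphi t) as Eq; simpl in Eq.
    replace (dot (v t) p) with
      (- (2 * 1 * sin (phi t) * cos (phi t)) / sqrt (kappa t ^ 2 + b ^ 2)).
    2: { simpl; rewrite <- Eq; field; apply Rgt_not_eq, Hsp. }
    unfold delta.
    replace ((kappa t ^ 2 + 1 - 1 ^ 2) / 2) with (2 * cos (phi t) ^ 2)
      by (rewrite Hk2; field).
    field; apply Rgt_not_eq, Hsp. }
  assert (Hdc : forall t, continuous delta t).
  { intros t.
    pose proof (cphase_derive Hphi t) as Hd.
    pose proof (system_w Hsys t) as Hw.
    pose proof (system_pos Hsys t) as Hp.
    apply (continuous_minus (V := R_NormedModule));
      apply (continuous_mult (K := R_AbsRing)).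
    - apply (ex_derive_continuous
        (fun t => - (sin (phi t) / sqrt (kappa t ^ 2 + b ^ 2)))).
      set (w := fun t => kappa t ^ 2) in *.
      apply (ex_derive_ext (fun t => - (sin (phi t) / sqrt (w t + b ^ 2))));
        [reflexivity|].
      auto_derive; repeat split; [eexists; exact Hd|eexists; exact Hw|exact Hp|].
      apply Rgt_not_eq, Hsp.
    - apply dot_continuous with (1 := frame_N_deriv Hf)
                                (2 := geod_r Hg).
    - apply (ex_derive_continuous (fun t => cos (phi t))).
      eexists; apply (phase_cos_derive 1 b _ _ _ t Hphi).
    - apply dot_continuous with (1 := frame_N_deriv Hf)
                                (2 := geod_v Hg). }
  assert (Hd1 : forall t, delta t ^ 2 = 1).
  { intros t.
    assert (E : delta t ^ 2 - 1 = 0); [|lra].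
    apply (vanishes_off_simple_zeros (fun t => cos (phi t)) _
             (fun t => delta t ^ 2 - 1)
             (fun t => phase_cos_derive 1 b _ _ _ t Hphi)
             (fun t => phase_cos_simple_zeros 1 b _ _ phi t Hsys)).
    - intros u; apply (continuous_minus (V := R_NormedModule));
        [|apply continuous_const].
      apply (continuous_mult (K := R_AbsRing)); [apply Hdc|].
      apply (continuous_mult (K := R_AbsRing)); [apply Hdc|apply continuous_const].
    - intros u; pose proof (Hk2 u) as E; rewrite Hkd in E.
      destruct (Req_dec (cos (phi u)) 0) as [E0|E0]; [rewrite E0; ring|].
      assert (E1 : cos (phi u) * (cos (phi u) * (delta u ^ 2 - 1)) = 0) by lra.
      apply Rmult_integral in E1; tauto. }
  assert (Hdn : forall t, delta t <> 0)
    by (intros t E; pose proof (Hd1 t) as E1; rewrite E in E1; lra).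
  assert (Hconst : forall t, delta t = delta 0).
  { intros t; apply nonvanishing_same_square; auto.
    rewrite !Hd1; reflexivity. }
  assert (E : (delta 0 - 1) * (delta 0 + 1) = 0)
    by (pose proof (Hd1 0); lra).
  apply Rmult_integral in E; destruct E as [E|E]; [left|right]; intros t;
    rewrite Hkd, Hconst.
  - replace (delta 0) with 1 by lra; ring.
  - replace (delta 0) with (-1) by lra; ring.
Qed.

(** For [a = 1] the equation of [geodesic_torsion] reads
    [kappa^2 (tau - b / 2) = 0].  At the zeros of [kappa], where [tau] could jump,
    consider [B + (b / 2) int N] componentwise: its derivative
    is [(b / 2 - tau) N]. *)
Lemma geodesic_constant_torsion {x v r : R -> vec3} {p : vec3} {b : R}
    {T N B : R -> vec3} {kappa tau : R -> R}
    (H : framed_geodesic x v r p 1 b T N B kappa tau) (phi : R -> R) (t : R) :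
  ~ linear_curve x ->
  curvature_phase 1 b (fun t => kappa t ^ 2) (fun t => dot (v t) p) phi ->
  tau t = b / 2.
Proof.
  intros Hnl Hphi.
  pose proof (framed_frame H) as Hf.
  pose proof (geodesic_curvature_system H Hnl) as Hsys.
  assert (Hoff : forall u, cos (phi u) * (b / 2 - tau u) = 0).
  { intros u.
    pose proof (geodesic_torsion H u Hnl) as E.
    pose proof (cphase_w Hphi u) as Ek; simpl in Ek.
    pose proof (sin2_cos2 (phi u)) as Es; unfold Rsqr in Es.
    assert (Ek2 : kappa u ^ 2 = 4 * cos (phi u) ^ 2) by (simpl; nra).
    rewrite Ek2 in E.
    destruct (Req_dec (cos (phi u)) 0) as [E0|E0]; [rewrite E0; ring|].
    assert (E1 : cos (phi u) * (cos (phi u) * (b / 2 - tau u)) = 0) by lra.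
    apply Rmult_integral in E1; tauto. }
  assert (Hcomp : forall n h : R -> R,
    (forall u, continuous n u) -> (forall u, is_derive h u (- tau u * n u)) ->
    (b / 2 - tau t) * n t = 0).
  { intros n h Hn Hh.
    destruct (continuous_antiderivative n 0 0 Hn) as (I & _ & HI).
    apply (derivative_vanishes_off_simple_zeros (fun t => cos (phi t)) _
             (fun u => h u + b / 2 * I u) (fun u => (b / 2 - tau u) * n u)
             (fun t => phase_cos_derive 1 b _ _ _ t Hphi)
             (fun t => phase_cos_simple_zeros 1 b _ _ phi t Hsys)).
    - intros u; pose proof (Hh u) as H1; pose proof (HI u) as H2.
      auto_derive; [repeat split; eexists; eauto|].
      derive_value H1; derive_value H2; field.
    - intros u; rewrite <- Rmult_assoc, Hoff; ring. }
  pose proof (fun u => is_derive_components _ _ _ (frame_N_deriv Hf u))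
    as HN.
  pose proof (fun u => is_derive_components _ _ _ (frame_B_deriv Hf u))
    as HB.
  assert (E1 : (b / 2 - tau t) * fst (fst (N t)) = 0).
  { apply (Hcomp (fun u => fst (fst (N u))) (fun u => fst (fst (B u)))).
    - intros u; apply (@ex_derive_continuous R_AbsRing R_NormedModule).
      eexists; exact (proj1 (HN u)).
    - intros u; exact (proj1 (HB u)). }
  assert (E2 : (b / 2 - tau t) * snd (fst (N t)) = 0).
  { apply (Hcomp (fun u => snd (fst (N u))) (fun u => snd (fst (B u)))).
    - intros u; apply (@ex_derive_continuous R_AbsRing R_NormedModule).
      eexists; exact (proj1 (proj2 (HN u))).
    - intros u; exact (proj1 (proj2 (HB u))). }
  assert (E3 : (b / 2 - tau t) * snd (N t) = 0).
  { apply (Hcomp (fun u => snd (N u)) (fun u => snd (B u))).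
    - intros u; apply (@ex_derive_continuous R_AbsRing R_NormedModule).
      eexists; exact (proj2 (proj2 (HN u))).
    - intros u; exact (proj2 (proj2 (HB u))). }
  pose proof (vnorm_1_dot _ (frame_N_unit Hf t)) as HNN.
  assert (E : (b / 2 - tau t) * dot (N t) (N t) = 0).
  { unfold dot.
    transitivity ((b / 2 - tau t) * fst (fst (N t)) * fst (fst (N t))
                  + (b / 2 - tau t) * snd (fst (N t)) * snd (fst (N t))
                  + (b / 2 - tau t) * snd (N t) * snd (N t)); [ring|].
    rewrite E1, E2, E3; ring. }
  rewrite HNN in E; lra.
Qed.

(** * Periods *)

Lemma cos_lt_1 (theta : R) : 0 < theta < 2 * PI -> cos theta < 1.
Proof.
  intros H.
  replace theta with (2 * (theta / 2)) by field.
  rewrite cos_2a_sin.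
  pose proof (sin_gt_0 (theta / 2)); nra.
Qed.

Theorem propositionA1
  (x y r : R -> vec3) (p : vec3) (a b : R)
  (T N B : R -> vec3) (kappa tau : R -> R) (omega k : R)
  (Hgeo : unit_speed_bicycling_geodesic x y r p)
  (Hpar : geodesic_parameters x y p a b)
  (Hb : 0 <= b)
  (Hnonlin : ~ linear_curve x)
  (Hframe : analytic_frenet_frame x T N B kappa tau)
  (Homega : omega = sqrt ((a + 1) ^ 2 + b ^ 2) / 2)
  (Hk0 : 0 <= k)
  (Hk : k ^ 2 = 4 * a / ((a + 1) ^ 2 + b ^ 2)) :
  let kappa2 := fun t => kappa t ^ 2 in
  let period := 2 * ellK k / omega in
  (exists t0, is_max_at kappa2 t0) /\
  (* (a) *)
  (forall t0, is_max_at kappa2 t0 ->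
     forall t, kappa2 (t0 + t) = (1 + a) ^ 2 - 4 * a * sn (omega * t) k ^ 2) /\
  (* (b); for a = 0 the curvature is constant and has no least period *)
  (a <> 1 ->
     is_period kappa2 period /\ is_period kappa period /\
     (a <> 0 -> is_least_period kappa2 period /\ is_least_period kappa period)) /\
  (* (c); for b = 0 one has k = 1, the period is infinite *)
  (a = 1 ->
     (exists tau0, forall t, tau t = tau0) /\
     (forall t0, is_max_at kappa2 t0 ->
        (forall t, kappa (t0 + t) = 2 * cn (omega * t) k) \/
        (forall t, kappa (t0 + t) = - (2 * cn (omega * t) k))) /\
     (b <> 0 ->
        2 * period = 4 * ellK k / omega /\ is_least_period kappa (2 * period)) /\
     (b = 0 -> forall P, ~ is_period kappa P)).
Proof.
  intros kappa2 period.
  pose proof (param_a_ge0 Hpar) as Ha.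
  pose proof (framed_geodesic_intro Hgeo Hpar Hframe) as H.
  pose proof (geodesic_curvature_system H Hnonlin) as Hsys.
  set (q := fun t => dot (minus (x t) (y t)) p) in Hsys.
  fold kappa2 in Hsys.
  assert (Hm : 0 < (a + 1) ^ 2 + b ^ 2) by nra.
  assert (Hom : 0 < omega)
    by (rewrite Homega; pose proof (sqrt_lt_R0 _ Hm); lra).
  assert (Hell : forall phi, curvature_phase a b kappa2 q phi ->
                             elliptic_phase omega k phi).
  { intros phi; apply (curvature_phase_elliptic a b kappa2 q); auto.
    apply (system_pos Hsys). }
  destruct (curvature_max_exists a b kappa2 q Ha Hsys) as (t1 & _ & Hmax1).
  destruct (curvature_phase_at_max a b kappa2 q t1 Ha Hsys Hmax1)
    as (phi & E1 & Hphi).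
  pose proof (Hell phi Hphi) as Hell1.
  assert (Hincr : forall u, 0 < u -> 0 < phi (t1 + u)).
  { intros u Hu; rewrite <- E1.
    apply (phase_increasing Hom Hell1); lra. }
  assert (Hk1 : a <> 1 \/ b <> 0 -> k ^ 2 < 1).
  { intros Hab; rewrite Hk.
    apply Rmult_lt_reg_r with ((a + 1) ^ 2 + b ^ 2); [exact Hm|].
    replace (4 * a / ((a + 1) ^ 2 + b ^ 2) * ((a + 1) ^ 2 + b ^ 2))
      with (4 * a) by (field; lra).
    assert (0 < (a - 1) ^ 2 + b ^ 2); [|nra].
    pose proof (pow2_ge_0 (a - 1)); pose proof (pow2_ge_0 b).
    destruct Hab as [Hab|Hab].
    - assert (0 < (a - 1) ^ 2); [|lra].
      apply pow2_gt_0; lra.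
    - assert (0 < b ^ 2); [|lra].
      apply pow2_gt_0; exact Hab. }
  assert (Hperiod : k ^ 2 < 1 -> 0 < period).
  { intros Hk2; unfold period.
    pose proof (ellK_pos k Hk2).
    apply Rmult_lt_0_compat; [lra|apply Rinv_0_lt_compat; exact Hom]. }
  assert (Hturn : k ^ 2 < 1 -> forall t, phi (t + period) = phi t + PI)
    by (intros Hk2 t; apply phase_half_turn; auto).
  split; [exists t1; exact Hmax1|].
  split.
  { intros t0 Hmax t.
    destruct (curvature_phase_at_max a b kappa2 q t0 Ha Hsys Hmax)
      as (psi & E0 & Hpsi).
    unfold sn.
    rewrite (phase_is_amplitude (Hell psi Hpsi) t0 t E0).
    apply (cphase_w Hpsi). }
  split.
  { intros Ha1.
    pose proof (Hk1 (or_introl Ha1)) as Hk2.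
    assert (Hp2 : is_period kappa2 period).
    { split; [auto|]; intros t.
      rewrite !(cphase_w Hphi), (Hturn Hk2), neg_sin; ring. }
    assert (Hp : is_period kappa period).
    { split; [auto|]; intros t.
      apply nonvanishing_same_square.
      - intros u; apply (geodesic_curvature_continuous H u Hnonlin).
      - intros u Eu.
        assert (E : kappa2 u = 0) by (unfold kappa2; rewrite Eu; ring).
        rewrite (cphase_w Hphi) in E.
        pose proof (sin2_cos2 (phi u)) as Es; unfold Rsqr in Es.
        assert (0 < (a - 1) ^ 2) by (apply pow2_gt_0; lra).
        nra.
      - apply Hp2. }
    split; [exact Hp2|]; split; [exact Hp|]; intros Ha0.
    assert (Hleast : forall Q, is_period kappa2 Q -> period <= Q).
    { intros Q [HQ EQ].
      destruct (Rle_or_lt period Q) as [L|L]; [exact L|exfalso].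
      specialize (EQ t1).
      rewrite !(cphase_w Hphi), E1, sin_0 in EQ.
      assert (Es : a * sin (phi (t1 + Q)) ^ 2 = 0) by lra.
      pose proof (Hincr Q HQ).
      assert (phi (t1 + Q) < PI).
      { replace PI with (phi (t1 + period)) by (rewrite (Hturn Hk2), E1; ring).
        apply (phase_increasing Hom Hell1); lra. }
      assert (0 < sin (phi (t1 + Q))) by (apply sin_gt_0; lra).
      apply Rmult_integral in Es; destruct Es as [Es|Es]; [lra|nra]. }
    split; (split; [assumption|]).
    - exact Hleast.
    - intros Q [HQ EQ]; apply Hleast; split; [exact HQ|].
      intros t; unfold kappa2; rewrite EQ; reflexivity. }
  intros ->.
  assert (Hret : forall Q, is_period kappa Q -> cos (phi (t1 + Q)) = 1).
  { intros Q [_ EQ]; specialize (EQ t1).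
    destruct (geodesic_signed_curvature H phi Hnonlin Hphi)
      as [E|E]; rewrite !E, E1, cos_0 in EQ; lra. }
  split; [|split; [|split]].
  - exists (b / 2); intros t.
    exact (geodesic_constant_torsion H phi t Hnonlin Hphi).
  - intros t0 Hmax.
    destruct (curvature_phase_at_max 1 b kappa2 q t0 Ha Hsys Hmax)
      as (psi & E0 & Hpsi).
    unfold cn.
    destruct (geodesic_signed_curvature H psi Hnonlin Hpsi)
      as [E|E]; [left|right]; intros t;
      rewrite (phase_is_amplitude (Hell psi Hpsi) t0 t E0); apply E.
  - intros Hb0.
    pose proof (Hk1 (or_intror Hb0)) as Hk2.
    assert (Hturn2 : forall t, phi (t + 2 * period) = phi t + 2 * PI).
    { intros t; replace (t + 2 * period) with (t + period + period) by ring.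
      rewrite !(Hturn Hk2); ring. }
    pose proof (Hperiod Hk2).
    split; [unfold period; field; lra|].
    split; [split; [lra|]|].
    + intros t.
      destruct (geodesic_signed_curvature H phi Hnonlin Hphi)
        as [E|E]; rewrite !E, Hturn2, cos_plus, cos_2PI, sin_2PI; ring.
    + intros Q HQ.
      destruct (Rle_or_lt (2 * period) Q) as [L|L]; [exact L|exfalso].
      pose proof (Hret Q HQ).
      assert (cos (phi (t1 + Q)) < 1); [|lra].
      apply cos_lt_1; split; [apply Hincr, HQ|].
      replace (2 * PI) with (phi (t1 + 2 * period)) by (rewrite Hturn2, E1; ring).
      apply (phase_increasing Hom Hell1); lra.
  - intros -> P HP.
    pose proof (Hret P HP) as EP.
    pose proof (Hincr P (proj1 HP)) as Hpos.
    pose proof PI_RGT_0.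
    destruct (Rlt_or_le (phi (t1 + P)) (PI / 2)) as [L|L].
    + pose proof (cos_lt_1 (phi (t1 + P))); lra.
    (* The phase cannot cross [PI / 2], where [w + b^2 = w] would vanish. *)
    + destruct (IVT_gen phi t1 (t1 + P) (PI / 2)) as (u & _ & Eu).
      * apply (phase_continuity Hell1).
      * rewrite E1, Rmin_left, Rmax_right; lra.
      * pose proof (system_pos Hsys u) as Hu.
        rewrite (cphase_w Hphi u), Eu, sin_PI2 in Hu; lra.
Qed.
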